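(* Let $f$ be an arbitrary (not necessarily continuous) antinorm on $\mathbb{R}^d_+$ and let $F$ be its continuous extension. Then $f^{**}=F$ on $\mathbb{R}^d_+$, where $f^{**}=(f^* )^*$.
   Context: $\mathbb{R}^d_+$ is the set of points of $\mathbb{R}^d$ with all coordinates nonnegative. An antinorm on a convex cone $K$ is a nonnegative, somewhere positive, concave, homogeneous functional $f:K\to[0,+\infty)$, where homogeneous means $f(\lambda\boldsymbol{x})=\lambda f(\boldsymbol{x})$ for all $\lambda\ge0$, $\boldsymbol{x}\in K$. The continuous extension of an antinorm $f$ on $\mathbb{R}^d_+$ is the unique continuous concave function $F$ on $\mathbb{R}^d_+$ which coincides with $f$ on $\operatorname{int}\mathbb{R}^d_+$ (it always exists; it may differ from $f$ on the boundary). The dual of an antinorm $f$ on $\mathbb{R}^d_+$ is the antinorm $$f^*(\boldsymbol{p})=\inf_{\boldsymbol{x}\in\mathbb{R}^d_+,\ f(\boldsymbol{x})\ne0}\frac{(\boldsymbol{p},\boldsymbol{x})}{f(\boldsymbol{x})},\qquad \boldsymbol{p}\in\mathbb{R}^d_+,$$ where $(\cdot,\cdot)$ is the standard inner product. *)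

(* Defs.v *)
From mathcomp Require Import all_boot all_order all_algebra.
From mathcomp Require Import all_classical all_reals all_analysis.
Set Implicit Arguments.
Unset Strict Implicit.
Unset Printing Implicit Defensive.
Import Order.TTheory GRing.Theory Num.Theory.
Import numFieldNormedType.Exports.
Local Open Scope classical_set_scope.
Local Open Scope ring_scope.

(* Functionals on a cone are total functions on the ambient space; every
   condition below constrains, and every infimum uses, only the values on the
   cone. *)

Definition orthant (R : realType) (d : nat) : set 'rV[R]_d :=
  [set x | forall i, 0 <= x ord0 i].

Definition dotp (R : realType) (d : nat) (p x : 'rV[R]_d) : R :=
  \sum_(i < d) p ord0 i * x ord0 i.

Definition concave_on (R : realType) (V : lmodType R) (K : set V)
    (f : V -> R) : Prop :=
  @convex_function R V K (fun x => - f x).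

Definition homogeneous_on (R : realType) (V : lmodType R) (K : set V)
    (f : V -> R) : Prop :=
  forall (l : R) (x : V), 0 <= l -> K x -> f (l *: x) = l * f x.

Definition antinorm (R : realType) (V : lmodType R) (K : set V)
    (f : V -> R) : Prop :=
  [/\ forall x, K x -> 0 <= f x,
      exists2 x, K x & 0 < f x,
      concave_on K f
    & homogeneous_on K f].

(* Continuity is for the topology induced on the closed orthant, so [F] is
   continuous up to the boundary, while [f] and [F] are only required to agree
   on the interior. *)
Definition continuous_extension (R : realType) (d : nat)
    (f F : 'rV[R]_d -> R) : Prop :=
  [/\ {within @orthant R d, continuous F},
      concave_on (@orthant R d) F
    & forall x, (@orthant R d)° x -> F x = f x].

(* [inf] is real-valued, with the junk value 0 on a set that is empty or
   unbounded below. For an antinorm [f] and [p] in the orthant, the set below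
   is nonempty and bounded below by 0. *)
Definition antinorm_dual (R : realType) (d : nat) (f : 'rV[R]_d -> R)
    (p : 'rV[R]_d) : R :=
  inf [set dotp p x / f x | x in [set x | @orthant R d x /\ f x != 0]].

(* Main.v *)
Require Import Defs.
From mathcomp Require Import all_boot all_order all_algebra.
From mathcomp Require Import all_classical all_reals all_analysis.
From mathcomp Require Import ring lra.
Set Implicit Arguments.
Unset Strict Implicit.
Unset Printing Implicit Defensive.
Import Order.TTheory GRing.Theory Num.Theory.
Import numFieldNormedType.Exports.
Local Open Scope classical_set_scope.
Local Open Scope ring_scope.

(** Write [f*] for the dual of [f], so that [f*(p) f(y) <= (p, y)] for all [p]
and [y] in the orthant ([antinorm_dual_mul_le]). Read with [y] fixed, this
Fenchel inequality says that [f(y)] is a lower bound of the quotients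
[(p, y) / f*(p)], that is, [f(y) <= f**(y)].

The opposite inequality at a point [y] with positive coordinates needs a [p]
that attains the infimum: a linear functional above [f] on the orthant and
equal to [f] at [y] ([superlinear_support]). It takes nonnegative values on the
basis vectors because [f] does, so [p] lies in the orthant, and [f*(p) >= 1],
whence [f**(y) <= (p, y) / f*(p) <= f(y)].

On the boundary [f] itself says nothing about [F], so a point [x] is approached
by the interior points [y t := x + t (1, ..., 1)], [t] positive, where [F]
coincides with [f]; both inequalities pass to the limit by continuity of [F].
For the upper bound, the functional [p] supporting [f] at [y t] is used at [x]
itself: [p] is nonnegative, so [(p, x) <= (p, y t)] and [f**(x) <= F(y t)].

The support functional is a finite-dimensional Hahn-Banach theorem for
superlinear functionals. One operator does all the work: replacing [q] by
[v |-> sup_s (q (v + s e) - s q e)], the directional derivative of [q] at [e],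
keeps [q] superlinear, does not decrease it, keeps its value at [e], and makes
it linear along the line of [e]. Applied at the point [y], it also extends [q]
from the orthant to the whole space; applied along each basis vector in turn,
it yields a linear functional. *)

(** * Superlinear functionals and convex cones *)

Definition superlinear (R : realType) (V : lmodType R) (K : set V)
    (q : V -> R) : Prop :=
  homogeneous_on K q /\ forall x y, K x -> K y -> q x + q y <= q (x + y).

Definition convex_cone (R : realType) (V : lmodType R) (K : set V) : Prop :=
  (forall l x, 0 <= l -> K x -> K (l *: x)) /\
  (forall x y, K x -> K y -> K (x + y)).

Lemma convex_coneT (R : realType) (V : lmodType R) : convex_cone [set: V].
Proof. by []. Qed.

(** Twice the midpoint inequality: homogeneity turns the mean of [f (2 x)] and
[f (2 y)] into the sum [f x + f y]. *)
Lemma concave_superlinear (R : realType) (V : lmodType R) (K : set V)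
    (f : V -> R) :
  convex_cone K -> concave_on K f -> homogeneous_on K f -> superlinear K f.
Proof.
move=> [KZ KD] fcv fhom; split=> // x y Kx Ky.
have h0 : 0 <= 2^-1 :> R by lra.
have h1 : 2^-1 <= 1 :> R by lra.
have hE : 1 - 2^-1 = 2^-1 :> R by lra.
have mid : - f (2^-1 *: (2%:R *: x) + (1 - 2^-1) *: (2%:R *: y)) <=
    2^-1 * - f (2%:R *: x) + (1 - 2^-1) * - f (2%:R *: y).
  by apply: (fcv (Itv01 h0 h1)); rewrite inE; apply: KZ; rewrite ?ler0n.
move: mid; rewrite hE !scalerA mulVf ?pnatr_eq0// !scale1r.
by rewrite !(fhom 2%:R) ?ler0n//; lra.
Qed.

(** * Making a superlinear functional linear along a direction *)

Section linear_along.
Context (R : realType) (V : lmodType R) (K : set V) (q : V -> R) (e : V).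
Hypotheses (Kcone : convex_cone K) (qlin : superlinear K q) (Ke : K e).
(* When [K] is the whole space this holds trivially; when [K] is the orthant it
   holds as soon as [e] has positive coordinates. *)
Hypothesis absorb : forall v, exists2 s, 0 <= s & K (v + s *: e).

(* The differences below are nondecreasing in [s], so their supremum is the limit
   at infinity of [q (v + s e) - q (s e)], which by homogeneity is the derivative
   of [q] at [e] in the direction [v]. *)
Let gains (v : V) : set R :=
  [set q (v + s *: e) - s * q e | s in [set s | 0 <= s /\ K (v + s *: e)]].

Definition extend_along (v : V) : R := sup (gains v).

Let q0 : q 0 = 0.
Proof. by have := qlin.1 0 e (lexx _) Ke; rewrite scale0r mul0r. Qed.

Let K0 : K 0.
Proof. by have := Kcone.1 0 e (lexx _) Ke; rewrite scale0r. Qed.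

Let gains_neq0 v : gains v !=set0.
Proof. by have [s s0 Ks] := absorb v; eexists; exists s. Qed.

(* If [- v + s0 e] is in [K], adding it to [v + s e] leaves [(s + s0) e], where
   [q] is known; this bounds [q (v + s e)] by superadditivity. *)
Let gains_ubound v : has_ubound (gains v).
Proof.
have [s0 s00 Ks0] := absorb (- v).
exists (s0 * q e - q (- v + s0 *: e)) => _ [s [s_ge0 Ks] <-].
have := qlin.2 _ _ Ks Ks0.
rewrite addrACA subrr add0r -scalerDl qlin.1 ?addr_ge0//; lra.
Qed.

Let le_extend v s : 0 <= s -> K (v + s *: e) ->
  q (v + s *: e) - s * q e <= extend_along v.
Proof.
by move=> s0 Ks; apply: (ub_le_sup (gains_ubound v)); exists s.
Qed.

Let extend_le v M :
  (forall s, 0 <= s -> K (v + s *: e) -> q (v + s *: e) - s * q e <= M) ->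
  extend_along v <= M.
Proof.
by move=> ubM; apply: ge_sup; [exact: gains_neq0|move=> _ [s [? ?] <-]; exact: ubM].
Qed.

Lemma extend_along_ge v : K v -> q v <= extend_along v.
Proof.
move=> Kv; have := @le_extend v 0 (lexx _).
by rewrite scale0r addr0 mul0r subr0; apply.
Qed.

(* Translations by [s] and [t] combine into a translation by [s + t], so the two
   suprema can be bounded one after the other. *)
Let extendD v w :
  extend_along v + extend_along w <= extend_along (v + w).
Proof.
rewrite -lerBrDr; apply: extend_le => s s0 Ks.
rewrite lerBrDl -lerBrDr; apply: extend_le => t t0 Kt.
have Kst := Kcone.2 _ _ Ks Kt; have qst := qlin.2 _ _ Ks Kt.
rewrite addrACA -scalerDl in Kst qst.
have := le_extend (addr_ge0 s0 t0) Kst; lra.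
Qed.

Let extend0 : extend_along 0 = 0.
Proof.
apply/eqP; rewrite eq_le; apply/andP; split.
  apply: extend_le => s s0 _.
  by rewrite add0r qlin.1 ?subrr.
by have := extend_along_ge K0; rewrite q0.
Qed.

(* Reparametrizing [s] as [l s] gives one inequality; the reverse one is the same
   statement for the scalar [l^-1]. *)
Let extendZ_ge l v : 0 < l -> l * extend_along v <= extend_along (l *: v).
Proof.
move=> l0; rewrite -ler_pdivlMl//; apply: extend_le => s s0 Ks.
rewrite ler_pdivlMl// mulrBr mulrA -qlin.1 ?(ltW l0)//.
rewrite scalerDr scalerA; apply: le_extend; first by rewrite mulr_ge0// ltW.
by rewrite -scalerA -scalerDr; apply: Kcone.1 => //; exact: ltW.
Qed.

Lemma superlinear_extend_along : superlinear [set: V] extend_along.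
Proof.
split=> [l v l0 _|v w _ _]; last exact: extendD.
have [->|lN0] := eqVneq l 0; first by rewrite scale0r mul0r extend0.
have {lN0} l_gt0 : 0 < l by rewrite lt_neqAle eq_sym lN0.
apply/eqP; rewrite eq_le extendZ_ge// andbT -ler_pdivrMl//.
have linv_gt0 : 0 < l^-1 by rewrite invr_gt0.
apply: le_trans (extendZ_ge (l *: v) linv_gt0) _.
by rewrite scalerA mulVf ?gt_eqF// scale1r.
Qed.

(* The translation [s = 1] brings [- e] back to the origin. *)
Let extendN_ge : - q e <= extend_along (- e).
Proof.
have := @le_extend (- e) 1 ler01.
by rewrite scale1r addNr mul1r q0 add0r; apply.
Qed.

Lemma extend_along_id : extend_along e = q e.
Proof.
apply/eqP; rewrite eq_le extend_along_ge// andbT.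
have := extendD e (- e); rewrite subrr extend0.
have := extendN_ge; lra.
Qed.

Lemma extend_alongN : extend_along (- e) = - extend_along e.
Proof.
apply/eqP; rewrite eq_le extend_along_id extendN_ge andbT.
have := extendD e (- e); rewrite subrr extend0 extend_along_id; lra.
Qed.

End linear_along.

(** * Linear functionals above a superlinear one *)

Lemma superlinear0 (R : realType) (V : lmodType R) (q : V -> R) :
  superlinear [set: V] q -> q 0 = 0.
Proof. by move=> [qZ _]; have := qZ 0 0 (lexx _) I; rewrite scale0r mul0r. Qed.

(** On a line where [q] is already linear there is no room left: superadditivity
gives [Q v + Q (- v) <= 0], while [Q >= q] bounds the two terms below by [q v]
and [- q v]. Hence later steps do not destroy linearity obtained earlier. *)
Lemma linear_direction_rigid (R : realType) (V : lmodType R) (q Q : V -> R)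
    (v : V) :
  superlinear [set: V] Q -> (forall w, q w <= Q w) -> q (- v) = - q v ->
  Q v = q v /\ Q (- v) = - Q v.
Proof.
move=> Qlin qQ qN; have := Qlin.2 v (- v) I I.
rewrite subrr superlinear0// => QN.
have := qQ v; have := qQ (- v); rewrite qN => h1 h2.
have Qv : Q v = q v by apply/eqP; rewrite eq_le h2 andbT; lra.
by split=> //; apply/eqP; rewrite eq_le Qv h1 andbT; lra.
Qed.

(** The extension operator is applied along the vectors of [s] one at a time. *)
Lemma superlinear_linear_on (R : realType) (V : lmodType R) (q : V -> R)
    (s : seq V) :
  superlinear [set: V] q ->
  exists Q : V -> R, [/\ superlinear [set: V] Q, forall v, q v <= Q v
    & forall e, e \in s -> Q (- e) = - Q e].
Proof.
move=> qlin; elim: s => [|e s [Q [Qlin qQ QN]]]; first by exists q; split.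
have absorb v : exists2 t : R, 0 <= t & [set: V] (v + t *: e) by exists 0.
have Te : [set: V] e by [].
have coneT := convex_coneT V.
have Q'Q v : Q v <= extend_along [set: V] Q e v by exact: extend_along_ge.
have Q'lin : superlinear [set: V] (extend_along [set: V] Q e).
  exact: superlinear_extend_along.
exists (extend_along [set: V] Q e); split=> // [v|e'].
  exact: le_trans (qQ v) (Q'Q v).
rewrite inE => /predU1P[->|/QN Qe']; first exact: extend_alongN.
by have [_] := linear_direction_rigid Q'lin Q'Q Qe'.
Qed.

(** Superadditivity over the expansion in the basis makes [q] at least the linear
functional with the same values at the basis vectors; the same bound at [- v]
then forces equality. *)
Lemma superlinear_dotp (R : realType) (d : nat) (q : 'rV[R]_d -> R) :
  superlinear [set: 'rV[R]_d] q ->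
  (forall j, q (- 'e_j) = - q 'e_j) ->
  forall v, q v = dotp (\row_j q 'e_j) v.
Proof.
move=> qlin qN.
have qZ (a : R) j : q (a *: 'e_j) = q 'e_j * a.
  have [a0|a0] := leP 0 a; first by rewrite qlin.1// mulrC.
  rewrite -{1}[a]opprK scaleNr -scalerN qlin.1 ?oppr_ge0 ?(ltW a0)// qN.
  by rewrite mulrNN mulrC.
have q_ge v : dotp (\row_j q 'e_j) v <= q v.
  rewrite {2}[v]row_sum_delta /dotp.
  rewrite (eq_bigr (fun j => q (v ord0 j *: 'e_j))); last first.
    by move=> j _; rewrite mxE qZ.
  elim/big_ind2 : _ => [|x1 x2 y1 y2 h1 h2|//]; first by rewrite superlinear0.
  by apply: le_trans (lerD h1 h2) _; exact: qlin.2.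
have dotN v : dotp (\row_j q 'e_j) (- v) = - dotp (\row_j q 'e_j) v.
  by rewrite /dotp -sumrN; apply: eq_bigr => j _; rewrite !mxE mulrN.
move=> v; apply/eqP; rewrite eq_le q_ge andbT.
have := qlin.2 v (- v) I I; rewrite subrr superlinear0//.
have := q_ge (- v); rewrite dotN; lra.
Qed.

(** * Support functionals on the orthant *)

Lemma orthant_cone (R : realType) (d : nat) : convex_cone (@orthant R d).
Proof.
split=> [l x l0 x0 i|x y x0 y0 i]; first by rewrite mxE mulr_ge0.
by rewrite mxE addr_ge0.
Qed.

Lemma orthant_absorb (R : realType) (d : nat) (x v : 'rV[R]_d) :
  (forall i, 0 < x ord0 i) -> exists2 s, 0 <= s & orthant (v + s *: x).
Proof.
move=> x0; pose c i := `|v ord0 i| / x ord0 i.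
have c0 i : 0 <= c i by rewrite divr_ge0 ?normr_ge0 ?ltW.
exists (\sum_i c i) => [|i]; first exact: sumr_ge0.
rewrite !mxE -lerBlDl sub0r; apply: (@le_trans _ _ (c i * x ord0 i)).
  by rewrite /c divfK ?gt_eqF// -normrN ler_norm.
by rewrite ler_pM2r// (bigD1 i)//= lerDl sumr_ge0.
Qed.

(** The first extension, along [x], fixes the value at [x] and makes it rigid, so
the later extensions along the basis keep it. *)
Lemma superlinear_support (R : realType) (d : nat) (q : 'rV[R]_d -> R)
    (x : 'rV[R]_d) :
  superlinear (@orthant R d) q -> (forall i, 0 < x ord0 i) ->
  exists p, dotp p x = q x /\ forall y, orthant y -> q y <= dotp p y.
Proof.
move=> qlin x0.
have Kx : orthant x by move=> i; exact: ltW.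
have coneK := orthant_cone R d.
have absorb v := orthant_absorb v x0.
pose Q0 := extend_along (@orthant R d) q x.
have Q0lin : superlinear [set: 'rV[R]_d] Q0.
  exact: superlinear_extend_along.
have [Q [Qlin Q0Q QN]] :=
  superlinear_linear_on [seq 'e_j | j <- enum 'I_d] Q0lin.
have QE : forall v, Q v = dotp (\row_j Q 'e_j) v.
  by apply: superlinear_dotp => // j; apply: QN; rewrite map_f// mem_enum.
exists (\row_j Q 'e_j); split=> [|y Ky]; rewrite -QE.
  have Q0N : Q0 (- x) = - Q0 x by exact: extend_alongN.
  have [-> _] := linear_direction_rigid Qlin Q0Q Q0N.
  exact: extend_along_id.
by apply: le_trans (Q0Q y); exact: extend_along_ge.
Qed.

(** * The dual functional *)

Lemma dotp_delta (R : realType) (d : nat) (p : 'rV[R]_d) (j : 'I_d) :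
  dotp p 'e_j = p ord0 j.
Proof.
rewrite /dotp (bigD1 j)//= mxE !eqxx mulr1 big1 ?addr0// => i ij.
by rewrite mxE (negbTE ij) mulr0.
Qed.

Lemma dotp_ge0 (R : realType) (d : nat) (p x : 'rV[R]_d) :
  orthant p -> orthant x -> 0 <= dotp p x.
Proof. by move=> p0 x0; apply: sumr_ge0 => i _; exact: mulr_ge0. Qed.

Lemma dotpDZ (R : realType) (d : nat) (p x y : 'rV[R]_d) (t : R) :
  dotp p (x + t *: y) = dotp p x + t * dotp p y.
Proof.
rewrite /dotp mulr_sumr -big_split; apply: eq_bigr => i _ /=.
by rewrite !mxE; ring.
Qed.

Lemma dotpC (R : realType) (d : nat) (p x : 'rV[R]_d) : dotp p x = dotp x p.
Proof. by apply: eq_bigr => i _; rewrite mulrC. Qed.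

Lemma antinorm_dual_ge0 (R : realType) (d : nat) (f : 'rV[R]_d -> R)
    (p : 'rV[R]_d) :
  (forall x, orthant x -> 0 <= f x) -> orthant p -> 0 <= antinorm_dual f p.
Proof.
move=> f0 p0; rewrite /antinorm_dual.
set A := (X in inf X).
have [->|A0] := eqVneq A set0; first by rewrite inf0.
apply: lb_le_inf; first exact/set0P.
by move=> _ [x [x0 _] <-]; rewrite divr_ge0 ?dotp_ge0 ?f0.
Qed.

(** The Fenchel inequality; as a product rather than a quotient it also covers the
points where [f] vanishes, which the infimum ignores. *)
Lemma antinorm_dual_mul_le (R : realType) (d : nat) (f : 'rV[R]_d -> R)
    (p x : 'rV[R]_d) :
  (forall x, orthant x -> 0 <= f x) -> orthant p -> orthant x ->
  antinorm_dual f p * f x <= dotp p x.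
Proof.
move=> f0 p0 x0; have [->|fxN0] := eqVneq (f x) 0.
  by rewrite mulr0 dotp_ge0.
rewrite -ler_pdivlMr; last by rewrite lt_neqAle eq_sym fxN0 f0.
apply: ge_inf; last by exists x.
by exists 0 => _ [y [y0 _] <-]; rewrite divr_ge0 ?dotp_ge0 ?f0.
Qed.

(** Some point with [f x != 0] is required: the infimum of the empty set is [0]. *)
Lemma le_antinorm_dual (R : realType) (d : nat) (f : 'rV[R]_d -> R)
    (p : 'rV[R]_d) (c : R) :
  (forall x, orthant x -> 0 <= f x) -> (exists2 x, orthant x & f x != 0) ->
  (forall x, orthant x -> c * f x <= dotp p x) -> c <= antinorm_dual f p.
Proof.
move=> f0 [x x0 fx] cf; apply: lb_le_inf; first by eexists; exists x.
move=> _ [y [y0 fy] <-]; rewrite ler_pdivlMr ?cf//.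
by rewrite lt_neqAle eq_sym fy f0.
Qed.

(** * Approaching the boundary from the interior *)

Lemma orthant_interior (R : realType) (d : nat) (x : 'rV[R]_d) :
  (forall i, 0 < x ord0 i) -> (@orthant R d)° x.
Proof.
move=> x0; have : \forall v \near x, forall i, 0 < (v : 'rV[R]_d) ord0 i.
  apply: (@filter_forall _ _ _ (nbhs x) _) => i.
  exact: (@coord_continuous R 1 d ord0 i x _ (lt_nbhsr (x0 i))).
by apply: filterS => v v0 i; exact/ltW/v0.
Qed.

Lemma cvg_orthant_shift (R : realType) (d : nat) (F : 'rV[R]_d -> R)
    (x w : 'rV[R]_d) :
  {within @orthant R d, continuous F} -> orthant x -> orthant w ->
  F (x + t *: w) @[t --> 0^'+] --> F x.
Proof.
move=> /subspace_continuousP Fc x0 w0.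
have := Fc x x0; apply: cvg_trans.
have shift : x + t *: w @[t --> 0^'+] --> within (@orthant R d) (nbhs x).
  move=> A /= xA.
  have cv : x + t *: w @[t --> (0 : R)^'+] --> x.
    apply: cvg_at_right_filter.
    rewrite -[X in _ --> X]addr0 -[X in _ + X](scale0r w).
    by apply: cvgD; [exact: cvg_cst|apply: cvgZr_tmp; exact: cvg_id].
  have := cv _ xA; apply: filterS2 (nbhs_right_ge (0 : R)) => t t0; apply=> i.
  by rewrite !mxE addr_ge0// mulr_ge0.
exact: (@cvg_comp _ _ _ _ F _ _ _ shift).
Qed.

(** * The bidual *)

Theorem theorem2 (R : realType) (d : nat) (f F : 'rV[R]_d -> R)
    (hf : antinorm (@orthant R d) f) (hF : continuous_extension f F) :
  forall x, @orthant R d x -> antinorm_dual (antinorm_dual f) x = F x.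
Proof.
move: hf hF => [f0 [z z0 fz] fcv fhom] [Fcont _ Ff] x x0.
have flin := concave_superlinear (orthant_cone R d) fcv fhom.
have fN0 : exists2 y, orthant y & f y != 0 by exists z; rewrite // gt_eqF.
pose u : 'rV[R]_d := const_mx 1.
have u0 : orthant u by move=> i; rewrite mxE ler01.
pose y t := x + t *: u.
have y_gt0 t : 0 < t -> forall i, 0 < y t ord0 i.
  by move=> t0 i; rewrite !mxE mulr1 ltr_wpDl.
have y_ge0 t : 0 < t -> orthant (y t) by move=> t0 i; exact/ltW/y_gt0.
have Fy t : 0 < t -> F (y t) = f (y t).
  by move=> t0; exact/Ff/orthant_interior/y_gt0.
have Fcvg : F (y t) @[t --> 0^'+] --> F x by exact: cvg_orthant_shift.
have g0 p : orthant p -> 0 <= antinorm_dual f p by exact: antinorm_dual_ge0.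
have supp t : 0 < t -> exists p,
    [/\ orthant p, 1 <= antinorm_dual f p & dotp p (y t) = F (y t)].
  move=> t0; have [p [px pf]] := superlinear_support flin (y_gt0 t t0).
  exists p; split; last by rewrite Fy.
    move=> j; rewrite -dotp_delta; apply: le_trans (pf _ _).
      by apply: f0 => i; rewrite mxE ler0n.
    by move=> i; rewrite mxE ler0n.
  by apply: le_antinorm_dual => // v v0; rewrite mul1r pf.
apply/eqP; rewrite eq_le; apply/andP; split.
  (* f**(x) <= f**(x) f*(p) <= (p, x) <= (p, y t) = F(y t) for p supporting at
     y t. *)
  apply: (cvgr_to_ge Fcvg); near=> t.
  have t0 : 0 < t by near: t; exact: nbhs_right_gt.
  have [p [p0 gp <-]] := supp t t0.
  rewrite dotpDZ; have := dotp_ge0 p0 u0; rewrite -(pmulr_rge0 _ t0) => pu.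
  have := antinorm_dual_mul_le g0 x0 p0; rewrite dotpC => le_px.
  apply: le_trans (le_trans le_px _); last by rewrite lerDl.
  by rewrite ler_peMr// antinorm_dual_ge0.
(* A support functional also witnesses that f* does not vanish identically. *)
have [p [p0 gp _]] := supp 1 ltr01.
apply: le_antinorm_dual => //.
  by exists p => //; rewrite gt_eqF// (lt_le_trans ltr01).
move=> {p p0 gp} p p0; rewrite dotpC.
have dcvg : dotp p x + t * dotp p u @[t --> 0^'+] --> dotp p x.
  apply: cvg_at_right_filter.
  rewrite -[X in _ --> X]addr0 -[X in _ + X](mul0r (dotp p u)).
  by apply: cvgD; [exact: cvg_cst|apply: cvgMr_tmp; exact: cvg_id].
have Fgcvg : F (y t) * antinorm_dual f p @[t --> 0^'+] -->
    F x * antinorm_dual f p by exact: cvgMr_tmp.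
apply: ler_cvg_to Fgcvg dcvg _; near=> t.
have t0 : 0 < t by near: t; exact: nbhs_right_gt.
rewrite Fy// mulrC -dotpDZ; apply: antinorm_dual_mul_le => //.
exact: y_ge0.
Unshelve. all: by end_near. Qed.
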